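(* Let $p$ be an odd prime, $n\ge1$, let $r>t\ge 0$ be integers and let $c\in\mathbb{F}_p^*$. Then: (i) $f(x)=\mathrm{Tr}_n\big(cx^{p^r+1}-cx^{p^t+1}\big)$ is near-bent if and only if $\gcd(n,r+t)=\gcd(n,r-t)=\gcd(n,p)=1$; (ii) $f(x)=\mathrm{Tr}_n\big(cx^{p^r+1}+cx^{p^t+1}\big)$ is near-bent if and only if $\gcd(n,2(r+t))=\gcd(n,2(r-t))=2$, $r-t$ is odd, and $\gcd(n,p)=1$.
   Context: $\epsilon_p=e^{2\pi i/p}$, $\mathrm{Tr}_n$ is the absolute trace $\mathbb{F}_{p^n}\to\mathbb{F}_p$, $\widehat{f}(b)=\sum_{x\in\mathbb{F}_{p^n}}\epsilon_p^{f(x)-\mathrm{Tr}_n(bx)}$. A function $f:\mathbb{F}_{p^n}\to\mathbb{F}_p$ is near-bent if $|\widehat{f}(b)|^2\in\{0,p^{n+1}\}$ for all $b\in\mathbb{F}_{p^n}$. *)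

(* Defs.v *)
From HB Require Import structures.
From mathcomp Require Import all_boot all_order all_algebra all_field.
Set Implicit Arguments. Unset Strict Implicit. Unset Printing Implicit Defensive.
Import Order.TTheory GRing.Theory Num.Theory.
Local Open Scope ring_scope.

Definition trn (F : finFieldType) (p n : nat) (x : F) : F :=
  \sum_(i < n) x ^+ (p ^ i).

(* The integer representative in {0,..,p-1} of an element y of the prime
   field F_p inside F (0 if y is not in the prime field). *)
Definition toFp (F : finFieldType) (p : nat) (y : F) : nat :=
  if [pick k : 'I_p | ((val k)%:R : F) == y] is Some k then val k else 0%N.

(* epsilon_p = e^{2 pi i / p}: p.-root (-1) is e^{i pi / p} (root with
   minimal nonnegative argument), so its square is e^{2 pi i / p}. *)
Definition eps (p : nat) : algC := (p.-root (-1)) ^+ 2.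

Definition walsh (F : finFieldType) (p n : nat) (f : F -> F) (b : F) : algC :=
  \sum_(x : F) eps p ^+ toFp p (f x - trn p n (b * x)).

Definition near_bent (F : finFieldType) (p n : nat) (f : F -> F) : Prop :=
  forall b : F, `|walsh p n f b| ^+ 2 = 0 \/ `|walsh p n f b| ^+ 2 = (p ^ n.+1)%:R.

(* Main.v *)
(** Put [a = r - t], [b = r + t], [s = -1] in (i) and [s = 1] in (ii), and let
    [sigma] be the Frobenius map.  Expanding [|W(b)|^2] for the quadratic form
    gives [p^n] times the sum of the character [w |-> eps^Tr(-bw)] over the
    radical [K = ker (sigma^a + s)(sigma^b + s)], because the form vanishes on
    [K]; so the function is near-bent iff [#|K| = p].
    For [s = -1], [K] contains the fixed fields of [sigma^a] and [sigma^b], of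
    sizes [p^gcd(n,a)] and [p^gcd(n,b)].  When both gcds are 1, [K] is the set
    of [y] with [sigma^a y - y] in the prime field; the image of [sigma^a - 1]
    is the kernel of the trace, which meets the prime field trivially iff
    [p] does not divide [n].
    For [s = 1], a nonzero [y] with [sigma^a y = -y] embeds the fixed field of
    [sigma^a] in [K], which forces [n] even and [a] odd; an element [th] with
    [sigma th = - th] then identifies [K] with the radical for [s = -1]. *)

Require Import Defs.
From HB Require Import structures.
From mathcomp Require Import all_boot all_order all_algebra all_field.
From mathcomp Require Import ring.
Import Order.TTheory GRing.Theory Num.Theory.
Local Open Scope ring_scope.

(** * Counting kernels, images and roots *)

Lemma card_le_ker_im (V W : finZmodType) (L : V -> W) :
  {morph L : x y / x - y} ->
  (#|V| <= #|[set x | L x == 0%R]| * #|[set L x | x in [set: V]]|)%N.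
Proof.
move=> LB; rewrite -cardsT -sum1_card.
(* Split [V] into the fibres of [L]; the fibre over [L x0] is the translate of the kernel by
   [x0]. *)
rewrite (partition_big L (mem [set L x | x in [set: V]])) /=; last first.
  by move=> x _; rewrite imset_f ?inE.
rewrite mulnC -sum_nat_const; apply: leq_sum => _ /imsetP[x0 _ ->].
rewrite -(card_imset _ (addrI x0)) -sum1_card.
rewrite [leqRHS](eq_bigl (fun x => L x == L x0)) => [|x].
  by rewrite [leqLHS](eq_bigl (fun x => L x == L x0)) // => x; rewrite !inE.
apply/imsetP/eqP => [[y]|Lx].
  rewrite inE => /eqP Ly ->.
  by apply/eqP; rewrite -subr_eq0 -LB addrAC subrr add0r Ly.
by exists (x - x0); rewrite ?inE ?LB ?Lx ?subrr // addrC subrK.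
Qed.

Lemma card_roots_lt (F : finFieldType) (P : {poly F}) :
  P != 0 -> (#|[set x | root P x]| < size P)%N.
Proof.
move=> P0; rewrite cardE; apply: max_poly_roots; rewrite ?enum_uniq //.
by apply/allP => x; rewrite mem_enum inE.
Qed.

(** * Powers of the Frobenius map and twisted traces *)

Section Frobenius.
Variables (F : finFieldType) (p n : nat).
Hypotheses (p_pr : prime p) (n_gt0 : (0 < n)%N) (cardF : #|F| = (p ^ n)%N).

Let p_gt0 : (0 < p)%N := prime_gt0 p_pr.
Let p_gt1 : (1 < p)%N := prime_gt1 p_pr.

Definition frob (k : nat) (x : F) : F := x ^+ (p ^ k).

Lemma pcharF : p \in [pchar F].
Proof. exact: card_finPcharP cardF p_pr. Qed.

Lemma frobD k : {morph frob k : x y / x + y}.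
Proof. by move=> x y; rewrite /frob exprDn_pchar // pnatX pnatE ?pcharF. Qed.
Lemma frobM k : {morph frob k : x y / x * y}.
Proof. by move=> x y; rewrite /frob exprMn. Qed.
Lemma frob_0 k : frob k 0 = 0.
Proof. by rewrite /frob expr0n expn_eq0 -leqn0 leqNgt p_gt0. Qed.
Lemma frob_1 k : frob k 1 = 1.
Proof. by rewrite /frob expr1n. Qed.
Lemma frobN k : {morph frob k : x / - x}.
Proof. by move=> x; apply/eqP; rewrite -addr_eq0 -frobD addNr frob_0. Qed.
Lemma frobB k : {morph frob k : x y / x - y}.
Proof. by move=> x y; rewrite frobD frobN. Qed.
Lemma frob_nat k m : frob k m%:R = m%:R.
Proof. by elim: m => [|m IH]; rewrite ?frob_0 // mulrSr frobD IH frob_1. Qed.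
Lemma frob_sum k (I : Type) (r : seq I) (P : pred I) (f : I -> F) :
  frob k (\sum_(i <- r | P i) f i) = \sum_(i <- r | P i) frob k (f i).
Proof. by apply: big_morph; [exact: frobD | exact: frob_0]. Qed.
Lemma frob0 x : frob 0 x = x. Proof. by []. Qed.
Lemma frob_add i j x : frob (i + j) x = frob i (frob j x).
Proof. by rewrite /frob -exprM -expnD addnC. Qed.
Lemma frobn x : frob n x = x.
Proof. by rewrite /frob -cardF expf_card. Qed.
Lemma frobC i j x : frob i (frob j x) = frob j (frob i x).
Proof. by rewrite -!frob_add addnC. Qed.
Lemma frob_eq0 k x : (frob k x == 0) = (x == 0).
Proof. by rewrite /frob expf_eq0 expn_gt0 p_gt0. Qed.
Lemma frob_inj k : injective (frob k).
Proof.
by move=> x y /eqP; rewrite -subr_eq0 -frobB frob_eq0 subr_eq0 => /eqP.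
Qed.

Lemma frob_fix_muln i k x : frob i x = x -> frob (k * i) x = x.
Proof. by move=> fx; elim: k => [|k IH]; rewrite ?frob0 // mulSn frob_add IH. Qed.

Lemma frob_fix_dvd i k x : (i %| k)%N -> frob i x = x -> frob k x = x.
Proof. by move=> /dvdnP[q ->]; apply: frob_fix_muln. Qed.

(** Bezout in the subtraction-free form [u * i = v * j + gcdn i j]: both multiples fix [x], hence so
    does the gcd. *)
Lemma frob_fix_gcd i j x :
  frob i x = x -> frob j x = x -> frob (gcdn i j) x = x.
Proof.
case: (posnP i) => [->|i_gt0] fi fj; first by rewrite gcd0n.
case: (egcdnP j i_gt0) => u v E _.
by rewrite -[RHS](frob_fix_muln i u) // E addnC frob_add (frob_fix_muln j v).
Qed.

(* For [d * m = n], [frob d] multiplies its values by [a^-1] when [a ^+ m = 1]: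
   [a = 1] gives the relative trace, [a = -1] anti-invariant elements. *)
Definition twtr (a : F) (d m : nat) (x : F) : F :=
  \sum_(i < m) a ^+ i * frob (d * i) x.

Lemma twtrB a d m : {morph twtr a d m : x y / x - y}.
Proof.
move=> x y; rewrite /twtr -sumrB; apply: eq_bigr => i _.
by rewrite frobB mulrBr.
Qed.

(** Telescoping: [a * frob d] shifts the summation index by one, losing the term [x] and gaining the
    term of index [m]. When these two agree, [a * frob d] fixes the sum. *)
Lemma twtr_frob a d m x : frob d a = a ->
  a * frob d (twtr a d m x) = twtr a d m x - x + a ^+ m * frob (d * m) x.
Proof.
move=> fa; have := erefl (twtr a d m.+1 x).
rewrite {1}/twtr big_ord_recl /= expr0 mul1r muln0 frob0 /twtr big_ord_recr /=.
move/(canRL (addKr _)) => E; rewrite addrAC [_ - x]addrC addrA -addrA -E.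
rewrite frob_sum mulr_sumr; apply: eq_bigr => i _.
have faX k : frob d (a ^+ k) = a ^+ k by rewrite /frob exprAC -/(frob d a) fa.
by rewrite frobM faX -frob_add -mulnS mulrA -exprS.
Qed.

(** [twtr a d m] is a polynomial function of degree [p ^ (d * m.-1)], and roots are bounded by the
    degree. *)
Lemma card_ker_twtr a d m : a != 0 -> (0 < d)%N -> (0 < m)%N ->
  (#|[set x | twtr a d m x == 0%R]| <= p ^ (d * m.-1))%N.
Proof.
move=> a0 d_gt0 m_gt0.
pose P : {poly F} := \sum_(i < m) a ^+ i *: 'X^(p ^ (d * i)).
have P0 : P != 0.
  apply/eqP => /(congr1 (fun q : {poly F} => q`_(p ^ (d * m.-1)))).
  rewrite coef0 coef_sum; have lt_m : (m.-1 < m)%N by rewrite prednK.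
  rewrite (bigD1 (Ordinal lt_m)) //= big1 ?addr0.
    by rewrite coefZ coefXn eqxx mulr1 => /eqP; rewrite expf_eq0 (negPf a0) andbF.
  move=> i ne; rewrite coefZ coefXn eqn_exp2l // eqn_pmul2l //.
  by rewrite eq_sym -val_eqE in ne *; rewrite (negPf ne) mulr0.
have szP : (size P <= (p ^ (d * m.-1)).+1)%N.
  apply: leq_trans (size_sum _ _ _) _; apply/bigmax_leqP => i _.
  apply: leq_trans (size_scale_leq _ _) _.
  rewrite size_polyXn ltnS leq_exp2l // leq_pmul2l // -ltnS prednK //.
have := leq_trans (card_roots_lt F P P0) szP; rewrite ltnS.
apply: leq_trans; apply: subset_leq_card; apply/subsetP => x.
rewrite !inE /root horner_sum => /eqP E; rewrite -[X in _ == X]E.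
by apply/eqP; apply: eq_bigr => i _; rewrite hornerZ hornerXn.
Qed.

Lemma twtr_neq0 a d m : a != 0 -> (0 < d)%N -> (0 < m)%N -> (d * m = n)%N ->
  exists x, twtr a d m x != 0.
Proof.
move=> a0 d_gt0 m_gt0 dm; apply/existsP; rewrite -negb_forall; apply/negP => /forallP H.
have := card_ker_twtr a d m a0 d_gt0 m_gt0.
rewrite (_ : [set x | _] = setT); last by apply/setP => x; rewrite !inE; apply: H.
by rewrite cardsT cardF -dm leq_exp2l // leq_pmul2l // leqNgt prednK // leqnn.
Qed.

(** * Fixed fields and the prime field *)

Definition fixf (d : nat) : {set F} := [set x | frob d x == x].

(** The relative trace maps [F] into [fixf d] with a kernel of at most [p ^ (n - d)] elements, so it
    takes at least [p ^ d] values. *)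
Lemma card_fixf_ge d : (d %| n)%N -> (p ^ d <= #|fixf d|)%N.
Proof.
move=> /dvdnP[m nE]; have [d_gt0 m_gt0] : (0 < d)%N /\ (0 < m)%N.
  by apply/andP; rewrite -muln_gt0 mulnC -nE.
have im : [set twtr 1 d m x | x in [set: F]] \subset fixf d.
  apply/subsetP => _ /imsetP[x _ ->]; rewrite inE -[X in X == _]mul1r.
  by rewrite twtr_frob ?frob_1 // expr1n mul1r mulnC -nE frobn subrK.
have := card_le_ker_im _ _ _ (twtrB 1 d m); rewrite cardF => le.
have ker := card_ker_twtr 1 d m (oner_neq0 _) d_gt0 m_gt0.
have := leq_trans le (leq_mul ker (subset_leq_card im)).
rewrite nE -{1}[m](prednK m_gt0) mulSn addnC [in leqLHS]mulnC expnD.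
by rewrite leq_pmul2l // expn_gt0 p_gt0.
Qed.

Lemma card_fixf1_le : (#|fixf 1| <= p)%N.
Proof.
have sz : size ('X^p - 'X : {poly F}) = p.+1.
  by rewrite size_polyDl size_polyXn // size_polyN size_polyX.
have P0 : ('X^p - 'X : {poly F}) != 0 by rewrite -size_poly_eq0 sz.
have := card_roots_lt _ _ P0; rewrite sz ltnS; apply: leq_trans.
apply: subset_leq_card; apply/subsetP => x; rewrite !inE /root => /eqP fx.
by rewrite hornerD hornerN hornerXn hornerX subr_eq0 -{2}fx /frob expn1.
Qed.

Lemma card_fixf1 : #|fixf 1| = p.
Proof.
apply/eqP; rewrite eqn_leq card_fixf1_le /=.
by have := card_fixf_ge 1 (dvd1n n); rewrite expn1.
Qed.

Lemma natr_eq_modF i j : (i%:R == j%:R :> F) = (i == j %[mod p])%N.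
Proof.
wlog le_ji : i j / (j <= i)%N.
  by move=> W; case/orP: (leq_total j i) => /W // E; rewrite eq_sym E eq_sym.
by rewrite eqn_mod_dvd // (dvdn_pcharf pcharF) natrB // subr_eq0.
Qed.

(** The [p] multiples of 1 are distinct and fixed, so they exhaust a fixed set of size [p]. *)
Lemma fixf1_nat x : frob 1 x = x -> exists2 k, (k < p)%N & x = k%:R.
Proof.
move=> fx; pose S := [set ((val k)%:R : F) | k : 'I_p].
have SF : S \subset fixf 1.
  by apply/subsetP => _ /imsetP[k _ ->]; rewrite inE frob_nat.
have cS : #|S| = p.
  rewrite card_imset ?card_ord // => i j /eqP; rewrite natr_eq_modF.
  by rewrite !modn_small ?ltn_ord // => /eqP/val_inj.
have : S == fixf 1 by rewrite eqEcard SF cS card_fixf1 leqnn.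
move=> /eqP/setP/(_ x); rewrite [in RHS]inE fx eqxx => /imsetP[k _ ->].
by exists k.
Qed.

(** * The maps [lin s a] and the radical [kset] *)

Definition lin (s : F) (a : nat) (x : F) : F := frob a x + s * x.

Lemma linB s a : {morph lin s a : x y / x - y}.
Proof. by move=> x y; rewrite /lin frobB mulrBr opprD addrACA. Qed.

Lemma linD s a : {morph lin s a : x y / x + y}.
Proof. by move=> x y; rewrite /lin frobD mulrDr addrACA. Qed.

Lemma lin0 s a : lin s a 0 = 0.
Proof. by rewrite -[X in lin s a X](subrr 0) linB subrr. Qed.

Lemma linN s a : {morph lin s a : x / - x}.
Proof. by move=> x; rewrite -[- x]sub0r linB lin0 sub0r. Qed.

Lemma linC s a b x : (forall k, frob k s = s) ->
  lin s a (lin s b x) = lin s b (lin s a x).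
Proof.
move=> fs; rewrite /lin !frobD !frobM !fs !mulrDr frobC -!addrA; congr (_ + _).
by rewrite addrCA.
Qed.

Lemma linN1_eq0 a x : (lin (-1) a x == 0) = (frob a x == x).
Proof. by rewrite /lin mulN1r subr_eq0. Qed.

Definition kset (s : F) (a b : nat) : {set F} :=
  [set x | lin s b (lin s a x) == 0].

Lemma frobN1 k : frob k (-1) = -1.
Proof. by rewrite frobN frob_1. Qed.

Lemma kset0 s a b : 0 \in kset s a b.
Proof. by rewrite inE !lin0. Qed.

Lemma ksetC s a b : (forall k, frob k s = s) -> kset s a b = kset s b a.
Proof. by move=> fs; apply/setP => x; rewrite !inE linC. Qed.

(** [fixf a] contains [fixf (gcdn n a)], which has at least [p ^ gcdn n a] elements. *)
Lemma fixf_card_gcd a : (#|fixf a| <= p)%N -> gcdn n a = 1%N.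
Proof.
move=> le; apply/eqP; rewrite eqn_leq gcdn_gt0 n_gt0 andbT.
rewrite -(leq_exp2l _ _ p_gt1) expn1; apply: leq_trans le.
apply: leq_trans (card_fixf_ge _ (dvdn_gcdl n a)) _.
apply/subset_leq_card/subsetP => x; rewrite !inE => /eqP fx.
by apply/eqP; apply: frob_fix_dvd fx; apply: dvdn_gcdr.
Qed.

Lemma fixf_gcd a x : gcdn n a = 1%N -> frob a x = x -> frob 1 x = x.
Proof. by move=> <- fx; apply: frob_fix_gcd; rewrite ?frobn. Qed.

Lemma frob1_fix k x : frob 1 x = x -> frob k x = x.
Proof. by apply: frob_fix_dvd; apply: dvd1n. Qed.

(** * The absolute trace and its kernel *)

Lemma trnE x : trn p n x = twtr 1 1 n x.
Proof. by apply: eq_bigr => i _; rewrite expr1n mul1r mul1n. Qed.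

Lemma trnB : {morph @trn F p n : x y / x - y}.
Proof. by move=> x y; rewrite !trnE twtrB. Qed.

Lemma trn_fix x : frob 1 (trn p n x) = trn p n x.
Proof.
rewrite trnE -[LHS]mul1r twtr_frob ?frob_1 //.
by rewrite expr1n mul1r mul1n frobn subrK.
Qed.

Lemma trn_frob k x : trn p n (frob k x) = trn p n x.
Proof.
rewrite -[RHS](frob1_fix k _ (trn_fix x)) /trn frob_sum.
by apply: eq_bigr => i _; apply: (frobC i k x).
Qed.

Lemma trn_of_fix x : frob 1 x = x -> trn p n x = x *+ n.
Proof.
move=> fx; rewrite /trn (eq_bigr (fun=> x)) ?sumr_const ?card_ord // => i _.
exact: frob1_fix.
Qed.

Lemma natF_eq0 m : (m%:R == 0 :> F) = (p %| m)%N.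
Proof. by rewrite (dvdn_pcharf pcharF). Qed.

Lemma gcdnp : (gcdn n p == 1%N) = ~~ (p %| n)%N.
Proof. by rewrite -/(coprime n p) coprime_sym prime_coprime. Qed.

(** Additive Hilbert 90 by counting: the image of [lin (-1) a] lies in the trace kernel, which has
    at most [p ^ n.-1] elements, while its own kernel [fixf a] is small enough to give it at least
    that many. *)
Lemma im_lin_trn0 a x : (#|fixf a| <= p)%N -> trn p n x = 0 ->
  exists y, frob a y = y + x.
Proof.
move=> le tx; pose T := [set z : F | trn p n z == 0].
pose I := [set lin (-1) a z | z in [set: F]].
suff : x \in I.
  case/imsetP => y _ ->; exists y.
  by rewrite /lin mulN1r addrC subrK.
suff /eqP -> : I == T by rewrite inE tx.
rewrite eqEcard; apply/andP; split.
  apply/subsetP => _ /imsetP[y _ ->].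
  by rewrite inE /lin mulN1r trnB trn_frob subrr.
have leT : (#|T| <= p ^ n.-1)%N.
  rewrite -[n.-1]mul1n; apply: leq_trans (card_ker_twtr 1 1 n _ _ _) => //.
    by apply/subset_leq_card/subsetP => z; rewrite !inE trnE.
  exact: oner_neq0.
apply: leq_trans leT _; have := card_le_ker_im _ _ _ (linB (-1) a).
rewrite cardF (_ : [set z | _] = fixf a); last first.
  by apply/setP => z; rewrite !inE linN1_eq0.
rewrite -{1}(prednK n_gt0) expnS => le2.
by rewrite -(leq_pmul2l p_gt0); apply: leq_trans le2 _; rewrite leq_mul2r le orbT.
Qed.

(** * Size of the radical for [s = -1] *)

Lemma card_ksetN1 a b : #|kset (-1) a b| = p <->
  [/\ gcdn n b = 1, gcdn n a = 1 & gcdn n p = 1]%N.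
Proof.
split=> [cK|[gb ga /eqP gp]]; last first.
  rewrite -card_fixf1; congr #|pred_of_set _|; apply/setP => x; rewrite !inE.
  apply/eqP/eqP => [/eqP|fx]; last first.
    rewrite (_ : lin (-1) a x = 0) ?lin0 //.
    by apply/eqP; rewrite linN1_eq0 (frob1_fix _ _ fx).
  (* The element [lin (-1) a x] lies in the prime field, so its trace is [n] times itself; that
     trace is 0 and [p] does not divide [n], so the element vanishes. *)
  rewrite linN1_eq0 => /eqP /(fixf_gcd _ _ gb) fu.
  have : trn p n (lin (-1) a x) == 0.
    by rewrite /lin mulN1r trnB trn_frob subrr.
  rewrite trn_of_fix // -mulr_natr mulf_eq0 natF_eq0 orbC.
  rewrite gcdnp in gp; rewrite (negPf gp) linN1_eq0 => /eqP.
  exact: fixf_gcd.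
have subA c d : fixf c \subset kset (-1) c d.
  by apply/subsetP => x; rewrite !inE -(linN1_eq0 c) => /eqP ->; rewrite lin0.
have lea : (#|fixf a| <= p)%N by rewrite -cK subset_leq_card.
have leb : (#|fixf b| <= p)%N by rewrite -cK ksetC ?subset_leq_card //; apply: frobN1.
have ga := fixf_card_gcd _ lea.
split=> //; first exact: fixf_card_gcd.
apply/eqP; rewrite gcdnp; apply/negP => pn.
(* If [p] divides [n], then 1 has trace 0 and some [y] satisfies [frob a y = y + 1]. This [y] lies
   in the radical, which by size is the prime field, so [frob a] should fix it. *)
have [|y fy] := im_lin_trn0 a 1 lea.
  by rewrite trn_of_fix ?frob_1 //; apply/eqP; rewrite natF_eq0.
have yK : y \in kset (-1) a b.
  by rewrite inE linN1_eq0 /lin mulN1r fy addrAC subrr add0r frob_1.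
have : fixf 1 == kset (-1) a b.
  rewrite eqEcard cK card_fixf1 leqnn andbT; apply: subset_trans (subA a b).
  by apply/subsetP => x; rewrite !inE => /eqP /(frob1_fix a) ->.
move=> /eqP/setP/(_ y); rewrite yK inE => /eqP /(frob1_fix a).
by move/eqP; rewrite fy -subr_eq0 addrAC subrr add0r oner_eq0.
Qed.

(** * Size of the radical for [s = 1] *)

Lemma exists_anti : ~~ odd n -> exists2 th : F, th != 0 & frob 1 th = - th.
Proof.
move=> n_even; have N10 : (-1 : F) != 0 by rewrite oppr_eq0 oner_eq0.
(* Twisting by -1 is consistent because [(-1) ^+ n = 1] for even [n]; then [- frob 1] fixes every
   value of the sum. *)
have [x th0] := twtr_neq0 (-1) 1 n N10 isT n_gt0 (mul1n n).
exists (twtr (-1) 1 n x) => //; apply: oppr_inj; rewrite -[LHS]mulN1r.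
rewrite twtr_frob ?frobN1 // mul1n frobn -signr_odd (negPf n_even) mul1r.
by rewrite subrK opprK.
Qed.

Lemma frob_anti th k : frob 1 th = - th -> frob k th = (-1) ^+ k * th.
Proof.
move=> fth; elim: k => [|k IH]; first by rewrite frob0 mul1r.
by rewrite -addn1 frob_add fth frobN IH exprD expr1 mulrN1 mulNr.
Qed.

Lemma lin_anti th k x : frob 1 th = - th -> odd k ->
  lin 1 k (th * x) = - th * lin (-1) k x.
Proof.
move=> fth k_odd; rewrite /lin frobM (frob_anti _ _ fth) -signr_odd k_odd.
by rewrite expr1 mulN1r mul1r mulrDr mulN1r mulrNN.
Qed.

(** Odd Frobenius powers negate [th], so multiplication by [th] exchanges [lin (-1)] and [lin 1] up
    to sign and carries one radical onto the other. *)
Lemma card_kset1_N1 a b : ~~ odd n -> odd a -> odd b ->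
  #|kset 1 a b| = #|kset (-1) a b|.
Proof.
move=> /exists_anti[th th0 fth] oa ob.
rewrite -[RHS](card_imset _ (mulfI th0)); congr #|pred_of_set _|.
have E x : (th * x \in kset 1 a b) = (x \in kset (-1) a b).
  rewrite !inE (lin_anti _ _ _ fth) // mulNr -mulrN lin_anti //.
  rewrite mulf_eq0 oppr_eq0 (negPf th0) /=.
  by rewrite linN oppr_eq0.
apply/setP => x; apply/idP/imsetP => [xK|[y yK ->]]; last by rewrite E.
by exists (th^-1 * x); rewrite -?E mulVKf.
Qed.

(** Multiplication by [y] embeds [fixf a] in the kernel, which forces [gcdn n a = 1]; so [a] is odd
    once [n] is even. *)
Lemma lin1_ker_gcd a y : odd p -> (#|[set x | lin 1%R a x == 0%R]| <= p)%N ->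
  y != 0 -> lin 1 a y = 0 -> ~~ odd n /\ odd a.
Proof.
move=> p_odd le y0 Ly.
have fy : frob a y = - y by apply/eqP; rewrite -addr_eq0 -[X in _ + X]mul1r -[_ + _]/(lin 1 a y) Ly.
have ga : gcdn n a = 1%N.
  apply: fixf_card_gcd; apply: leq_trans le; rewrite -(card_imset _ (mulIf y0)).
  apply/subset_leq_card/subsetP => _ /imsetP[x + ->]; rewrite !inE => /eqP fx.
  by rewrite /lin frobM fx fy mulrN mul1r addNr.
have n_even : ~~ odd n.
  (* For odd [n], [y] is fixed by [frob (2 * a)] and hence lies in the prime field; then [y = - y],
     absurd in odd characteristic. *)
  apply/negP => n_odd; have g2 : gcdn n (2 * a) = 1%N.
    by rewrite Gauss_gcdr ?coprimen2.
  have /(frob1_fix a) : frob 1 y = y.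
    by rewrite -g2; apply: frob_fix_gcd; rewrite ?frobn // mul2n -addnn frob_add fy frobN fy opprK.
  move/eqP; rewrite fy eq_sym -addr_eq0 -mulr2n -mulr_natr mulf_eq0 (negPf y0) natF_eq0.
  by rewrite dvdn_prime2 // => /eqP p2; rewrite p2 in p_odd.
split=> //; apply: contraT => a_even; have : (2 %| gcdn n a)%N.
  by rewrite dvdn_gcd !dvdn2 n_even.
by rewrite ga.
Qed.

Lemma gcdn_double_even k : ~~ odd n -> odd k ->
  (gcdn n (2 * k) = 2 <-> gcdn n k = 1)%N.
Proof.
rewrite -dvdn2 => /dvdnP[m ->] k_odd; rewrite mulnC -muln_gcdr.
rewrite (gcdnC (2 * m) k) Gauss_gcdr ?coprimen2 // (gcdnC k); split=> [/eqP|->//].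
by rewrite -{2}[2%N]muln1 eqn_pmul2l // => /eqP.
Qed.

Lemma card_kset1 a b : odd p -> odd a = odd b -> #|kset 1 a b| = p <->
  [/\ gcdn n (2 * b) = 2, gcdn n (2 * a) = 2, odd a & gcdn n p = 1]%N.
Proof.
move=> p_odd oab; split=> [cK|[gb ga oa gp]]; last first.
  have n_even : ~~ odd n by rewrite -dvdn2 -{1}ga dvdn_gcdl.
  have ob : odd b by rewrite -oab.
  rewrite card_kset1_N1 //; apply/card_ksetN1; split=> //.
    exact/gcdn_double_even.
  exact/gcdn_double_even.
have subA c d : [set x | lin 1 c x == 0] \subset kset 1 c d.
  by apply/subsetP => x; rewrite !inE => /eqP ->; rewrite lin0.
have fr k : frob k 1 = 1 by exact: frob_1.
have [x /andP[x0 xK]] : exists x, (x != 0) && (x \in kset 1 a b).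
  apply/existsP; rewrite -[X in is_true X]negbK negb_exists; apply/negP => /forallP H.
  have : kset 1 a b \subset [set 0].
    by apply/subsetP => x xK; have := H x; rewrite xK andbT negbK inE.
  by move/subset_leq_card; rewrite cK cards1 leqNgt p_gt1.
have [n_even oa] : ~~ odd n /\ odd a.
  (* Either [x] itself is killed by [lin 1 a], or [lin 1 a x] is a nonzero element killed by
     [lin 1 b]. *)
  have [Lx|Lx] := eqVneq (lin 1 a x) 0.
    apply: (lin1_ker_gcd _ _ p_odd _ x0 Lx).
    by rewrite -cK subset_leq_card.
  rewrite oab; apply: (lin1_ker_gcd _ _ p_odd _ Lx); last by apply/eqP; rewrite inE in xK.
  by rewrite -cK ksetC // subset_leq_card.
have ob : odd b by rewrite -oab.
move: cK; rewrite card_kset1_N1 // => /card_ksetN1[gb ga gp].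
by split=> //; apply/gcdn_double_even.
Qed.

(** * Additive characters and their sums *)

Hypothesis p_odd : odd p.

Lemma eps_prim : p.-primitive_root (eps p).
Proof.
set w : algC := p.-root (-1).
have wp : w ^+ p = -1 by rewrite rootCK.
have ep : eps p ^+ p = 1 by rewrite /eps exprAC wp sqrrN expr1n.
have [m m_prim m_dvd] := prim_order_exists p_gt0 ep.
(* The order of [eps p] is 1 or [p]. Order 1 would make [w] equal to 1, against [w ^+ p = -1], or to
   -1, but [p.-root] is never negative. *)
have /primeP[_ /(_ m m_dvd)/orP[/eqP m1|/eqP mp]] := p_pr; last first.
  by rewrite mp in m_prim.
have := prim_expr_order m_prim; rewrite m1 expr1 /eps -/w => /eqP.
rewrite sqrf_eq1 => /orP[] /eqP wE; move: wp; rewrite wE.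
  by rewrite expr1n => /eqP; rewrite -addr_eq0 -mulr2n pnatr_eq0.
by have := rootC_lt0 (-1 : algC) p_gt1; rewrite -/w wE ltrN10.
Qed.

Lemma toFp_nat k : toFp p (k%:R : F) = (k %% p)%N.
Proof.
rewrite /toFp; case: pickP => [i /=|/(_ (Ordinal (ltn_pmod k p_gt0)))/=].
  by rewrite natr_eq_modF (modn_small (ltn_ord i)) => /eqP ->.
by rewrite GRing.natr_mod_pchar ?eqxx ?pcharF.
Qed.

Definition chi (z : F) : algC := eps p ^+ toFp p (trn p n z).

Lemma trn_0 : trn p n (0 : F) = 0.
Proof. by rewrite trn_of_fix ?frob_0 ?mul0rn. Qed.

Lemma trnN : {morph @trn F p n : x / - x}.
Proof. by move=> x; rewrite -sub0r trnB trn_0 sub0r. Qed.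

Lemma trnD : {morph @trn F p n : x y / x + y}.
Proof. by move=> x y; rewrite -{1}[y]opprK trnB trnN opprK. Qed.

Lemma trn_nat (z : F) : exists2 k, (k < p)%N & trn p n z = k%:R.
Proof. by apply: fixf1_nat; apply: trn_fix. Qed.

Lemma chi_trn0 (z : F) : trn p n z = 0 -> chi z = 1.
Proof. by move=> tz; rewrite /chi tz (toFp_nat 0) mod0n. Qed.

Lemma chi0 : chi 0 = 1.
Proof. by rewrite chi_trn0 // trn_0. Qed.

Lemma chiD x y : chi (x + y) = chi x * chi y.
Proof.
rewrite /chi trnD; have [k _ ->] := trn_nat x; have [l _ ->] := trn_nat y.
by rewrite -natrD !toFp_nat !(prim_expr_mod eps_prim) exprD.
Qed.

(** A root of unity has modulus 1, so its conjugate is its inverse. *)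
Lemma conj_chi x : (chi x)^* = chi (- x).
Proof.
have chiN0 : chi x * chi (- x) = 1 by rewrite -chiD subrr chi0.
have chi1 : `|chi x| = 1.
  apply/eqP; rewrite -(pexpr_eq1 p_gt0) // -normrX /chi exprAC.
  by rewrite (prim_expr_order eps_prim) expr1n normr1.
have chiC : chi x * (chi x)^* = 1 by rewrite -normCK chi1 expr1n.
by rewrite -[LHS]mul1r -chiN0 mulrAC chiC mul1r.
Qed.

Lemma chi_nontriv u : u != 0 -> exists z, chi (z * u) != 1.
Proof.
move=> u0; have [x] := twtr_neq0 1 1 n (oner_neq0 _) isT n_gt0 (mul1n n).
rewrite -trnE => tx; exists (x / u); rewrite mulfVK //.
move: tx; rewrite /chi; have [k lt_k ->] := trn_nat x.
by rewrite natF_eq0 toFp_nat -(prim_order_dvd eps_prim) /dvdn modn_mod.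
Qed.

(** If the character is not 1 at some [w] in [K], translation by [w] permutes the finite set [K] and
    multiplies the sum by a factor other than 1. *)
Lemma sum_chi_sub (K : {set F}) b :
  {in K &, forall x y, x + y \in K} ->
  \sum_(w in K) chi (b * w) = 0 \/ \sum_(w in K) chi (b * w) = #|K|%:R.
Proof.
move=> KD; case: (boolP [forall w in K, chi (b * w) == 1]) => [/forall_inP H|].
  right; rewrite -sumr_const; apply: eq_bigr => w /H/eqP //.
rewrite negb_forall_in => /exists_inP[w wK ne]; left.
have wD : [set w + x | x in K] = K.
  apply/eqP; rewrite eqEcard card_imset ?leqnn ?andbT; last exact: addrI.
  by apply/subsetP => _ /imsetP[x xK ->]; apply: KD.
have : \sum_(x in K) chi (b * x) = chi (b * w) * \sum_(x in K) chi (b * x).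
  rewrite -{1}wD big_imset /=; last by move=> x y _ _; apply: addrI.
  by rewrite mulr_sumr; apply: eq_bigr => x _; rewrite mulrDr chiD.
move/eqP; rewrite -subr_eq0 -{1}[\sum_(x in K) _]mul1r -mulrBl mulf_eq0.
by rewrite subr_eq0 eq_sym (negPf ne) => /eqP.
Qed.

Lemma sum_chi u : \sum_x chi (x * u) = if u == 0 then (p ^ n)%:R else 0.
Proof.
have [->|u0] := eqVneq u 0.
  rewrite (eq_bigr (fun=> 1)) => [|x _]; last by rewrite mulr0 chi0.
  by rewrite sumr_const cardF.
have [z ne] := chi_nontriv u u0.
have : \sum_x chi (x * u) = chi (z * u) * \sum_x chi (x * u).
  rewrite [LHS](reindex_inj (addrI z)) mulr_sumr; apply: eq_bigr => x _.
  by rewrite mulrDl chiD.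
move/eqP; rewrite -subr_eq0 -{1}[\sum_x _]mul1r -mulrBl mulf_eq0.
by rewrite subr_eq0 eq_sym (negPf ne) => /eqP.
Qed.

(** * The quadratic form and its Walsh transform *)

Section Quadratic.
Variables (c s : F) (r t : nat).
Hypotheses (c0 : c != 0) (fc : forall k, frob k c = c).
Hypotheses (s2 : s * s = 1) (fs : forall k, frob k s = s) (le_tr : (t <= r)%N).

Let g (x : F) := c * (frob r x * x) + s * (c * (frob t x * x)).
Let polar (x w : F) :=
  c * (frob r x * w) + c * (x * frob r w)
  + (s * (c * (frob t x * w)) + s * (c * (x * frob t w))).
Let K := kset s (r - t) (r + t).

Lemma polarE x w : g (x + w) = g x + g w + polar x w.
Proof. by rewrite /g /polar !frobD; ring. Qed.

(** The trace is Frobenius-invariant, so each term can be shifted, by [r] or [r - t], until [x]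
    occurs only as [frob r x]. *)
Lemma trn_polar x w : trn p n (polar x w)
  = trn p n (frob r x * (c * lin s (r + t) (lin s (r - t) w))).
Proof.
have -> : frob r x * (c * lin s (r + t) (lin s (r - t) w)) =
    c * (frob r x * w) + c * (frob r x * frob (r + r) w)
    + (s * (c * (frob r x * frob (r - t) w))
       + s * (c * (frob r x * frob (r + t) w))).
  have -> : (r + r = (r + t) + (r - t))%N by rewrite -addnA subnKC.
  rewrite /lin frobD frobM fs (frob_add (r + t)) [s * (_ + s * w)]mulrDr.
  by rewrite (mulrA s s) s2 mul1r; ring.
rewrite /polar !trnD; congr (_ + _ + (_ + _)).
- by rewrite -[LHS](trn_frob r) !frobM fc -frob_add.
- by rewrite -[LHS](trn_frob (r - t)) !frobM fc fs -frob_add subnK.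
- by rewrite -[LHS](trn_frob r) !frobM fc fs -frob_add.
Qed.

(** [polar w w] is twice [g w], and 2 is invertible. *)
Lemma trn_g_kset w : w \in K -> trn p n (g w) = 0.
Proof.
rewrite inE => /eqP Lw; have := trn_polar w w.
have -> : polar w w = g w + g w by rewrite /polar /g; ring.
rewrite Lw !mulr0 trnD trn_0 => /eqP.
rewrite -mulr2n -mulr_natr mulf_eq0 natF_eq0 dvdn_prime2 // orbC.
by case: eqP => [p2|_ /eqP //]; move: (p_odd); rewrite p2.
Qed.

Lemma walsh_sqr (f : F -> F) b : (forall x, f x = trn p n (g x)) ->
  `|walsh p n f b| ^+ 2 = (p ^ n)%:R * \sum_(w in K) chi (- b * w).
Proof.
move=> fE; pose h x := g x - b * x.
have WE : walsh p n f b = \sum_x chi (h x).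
  by apply: eq_bigr => x _; rewrite fE -trnB.
rewrite normCK WE rmorph_sum mulr_sumr.
(* Substitute [x + w] for the index of the first factor: [h (x + w) - h x = h w + polar x w]. *)
transitivity (\sum_x \sum_w chi (h w) * chi (polar x w)).
  apply: eq_bigr => x _; rewrite /= conj_chi mulr_suml.
  rewrite (reindex_inj (addrI x)); apply: eq_bigr => w _.
  by rewrite -!chiD; congr chi; rewrite /h polarE; ring.
rewrite exchange_big mulr_sumr [RHS]big_mkcond; apply: eq_bigr => w _ /=.
rewrite -mulr_sumr.
(* [frob r] permutes [F], so [frob r x] may be replaced by [x], which makes the sum an orthogonality
   relation. *)
have -> : \sum_x chi (polar x w) =
    \sum_x chi (x * (c * lin s (r + t) (lin s (r - t) w))).
  rewrite [RHS](reindex_inj (frob_inj r)); apply: eq_bigr => x _.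
  by rewrite /chi trn_polar.
rewrite sum_chi mulf_eq0 (negPf c0) /= /K inE.
case: ifP => Lw; last by rewrite mulr0.
by rewrite mulrC chiD [chi (g w)]chi_trn0 ?mul1r ?mulNr // trn_g_kset // inE.
Qed.

(** At [b = 0] the squared modulus is [p ^ n * #|K|], which is nonzero because [K] contains 0.
    Conversely, each character sum over [K] is 0 or [#|K|]. *)
Lemma near_bentE (f : F -> F) : (forall x, f x = trn p n (g x)) ->
  near_bent p n f <-> #|K| = p.
Proof.
move=> fE; have pn0 : (p ^ n)%:R != 0 :> algC.
  by rewrite pnatr_eq0 expn_eq0 negb_and -lt0n p_gt0.
split=> [/(_ 0)|cK b]; rewrite (walsh_sqr _ _ fE).
  rewrite oppr0 (eq_bigr (fun=> 1)) ?sumr_const; last first.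
    by move=> w _; rewrite mul0r chi0.
  rewrite -natrM => -[] /eqP.
    rewrite pnatr_eq0 muln_eq0 expn_eq0 eqn0Ngt p_gt0 cards_eq0 /= => /eqP K0.
    by have := kset0 s (r - t) (r + t); rewrite -/K K0 inE.
  by rewrite eqr_nat expnSr eqn_pmul2l ?expn_gt0 ?p_gt0 // => /eqP.
have KD : {in K &, forall x y, x + y \in K}.
  move=> x y; rewrite !inE => /eqP Lx /eqP Ly.
  by rewrite (linD s (r - t)) (linD s (r + t)) Lx Ly addr0.
have [->|->] := sum_chi_sub K (- b) KD; first by left; rewrite mulr0.
by right; rewrite cK -natrM expnSr.
Qed.

End Quadratic.
End Frobenius.

Theorem theorem4 (p n r t : nat) (F : finFieldType) (c : 'I_p) :
  prime p -> odd p -> (0 < n)%N -> #|F| = (p ^ n)%N -> (t < r)%N -> (0 < c)%N ->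
  (near_bent p n
     (fun x : F => trn p n ((val c)%:R * x ^+ (p ^ r + 1) - (val c)%:R * x ^+ (p ^ t + 1)))
   <-> [/\ gcdn n (r + t) = 1%N, gcdn n (r - t) = 1%N & gcdn n p = 1%N])
  /\
  (near_bent p n
     (fun x : F => trn p n ((val c)%:R * x ^+ (p ^ r + 1) + (val c)%:R * x ^+ (p ^ t + 1)))
   <-> [/\ gcdn n (2 * (r + t)) = 2%N, gcdn n (2 * (r - t)) = 2%N,
           odd (r - t) & gcdn n p = 1%N]).
Proof.
move=> p_pr p_odd n_gt0 cardF lt_tr c_gt0.
have c0 : (val c)%:R != 0 :> F.
  by rewrite (natF_eq0 F p n) // gtnNdvd ?ltn_ord.
have fc k : frob F p k (val c)%:R = (val c)%:R :> F by apply: (frob_nat F p n).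
have le_tr := ltnW lt_tr.
split.
  rewrite -(card_ksetN1 F p n) //.
  apply: (near_bentE F p n _ _ _ _ _ _ r t c0 fc) => // [|k|x].
  - by rewrite mulrNN mulr1.
  - by apply: (frobN1 F p n).
  by rewrite mulN1r !exprD !expr1.
rewrite -(card_kset1 F p n) //; last by rewrite oddB // oddD.
apply: (near_bentE F p n _ _ _ _ _ _ r t c0 fc) => // [|k|x].
- by rewrite mulr1.
- exact: frob_1.
by rewrite mul1r !exprD !expr1.
Qed.
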